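(* For $p,q\in\mathbb{C}$ let $B(p:q)=\begin{pmatrix}1&p\\ q&0\end{pmatrix}$. Then $B(p:q)$ is equivalent to $B(cp:cq)$ for every $c\in\mathbb{C}^*$, so the stratum $B(p:q)$ has projective coordinates. Moreover, for all $p,q,x,y\in\mathbb{C}$, $B(p:q)$ is equivalent to $B(x:y)$ if and only if $(p:q)=(x:y)$ or $(p:q)=(y:x)$. This means that the stratum is parametrized by $\mathbb{P}^1/\Sigma_2$, that is, $(p:q)\mapsto B(p:q)$ induces a bijection from $\mathbb{P}^1/\Sigma_2$ onto the set of equivalence classes of matrices of the form $B(p:q)$.
   Context: Two matrices $M,M'\in M_2(\mathbb{C})$ are equivalent if there is $G\in GL(2,\mathbb{C})$ with $G^TMG=M'$ (congruence, also called the cogredient action). Convention: $\mathbb{P}^1$ here includes, in addition to the usual points of the complex projective line, the ''generic'' point $(0:0)$; that is, it is the set of orbits of $\mathbb{C}^2$ (including the origin) under scalar multiplication by $\mathbb{C}^*$. Accordingly $(p:q)=(x:y)$ means that there is $c\in\mathbb{C}^*$ with $x=cp$ and $y=cq$. The symmetric group $\Sigma_2$ acts on $\mathbb{P}^1$ by interchanging the coordinates, $(p:q)\mapsto(q:p)$. *)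

(* Defs.v *)
From HB Require Import structures.
From mathcomp Require Import all_boot all_order all_algebra all_fingroup.
From mathcomp Require Import boolp classical_sets functions reals complex.

Set Implicit Arguments.
Unset Strict Implicit.
Unset Printing Implicit Defensive.

Import GRing.Theory.
Local Open Scope classical_set_scope.
Local Open Scope ring_scope.

Section Definitions.
Variable F : fieldType.

Definition congruent (M M' : 'M[F]_2) : Prop :=
  exists2 G : 'M[F]_2, G \in unitmx & G^T *m M *m G = M'.

Definition congruence_class (M : 'M[F]_2) : set 'M[F]_2 :=
  [set M' | congruent M M'].

Definition B (p q : F) : 'M[F]_2 :=
  \matrix_(i, j) if i == 0 then (if j == 0 then 1 else p)
                 else (if j == 0 then q else 0).

Definition vec2 (p q : F) : 'rV[F]_2 := \row_j if j == 0 then p else q.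

(* (p : q) is the orbit of (p, q) under F^*; p = q = 0 is allowed. *)
Definition proj_point (p q : F) : set 'rV[F]_2 :=
  [set c *: vec2 p q | c in [set c : F | c != 0]].

Definition P1 : set (set 'rV[F]_2) :=
  [set L | exists p q : F, L = proj_point p q].

(* A permutation of the coordinates acts on P1 by taking images of orbits. *)
Definition sym_act (s : 'S_2) (L : set 'rV[F]_2) : set 'rV[F]_2 :=
  [set col_perm s v | v in L].

Definition sym_orbit (L : set 'rV[F]_2) : set (set 'rV[F]_2) :=
  [set sym_act s L | s in @setT 'S_2].

Definition P1_mod_sym : set (set (set 'rV[F]_2)) := [set sym_orbit L | L in P1].

Definition B_classes : set (set 'M[F]_2) :=
  [set K | exists p q : F, K = congruence_class (B p q)].

Lemma congruent_refl (M : 'M[F]_2) : congruent M M.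
Proof. by exists 1%:M; rewrite ?unitmx1 // trmx1 mul1mx mulmx1. Qed.

Lemma congruent_sym (M M' : 'M[F]_2) : congruent M M' -> congruent M' M.
Proof.
case=> G uG <-; exists (invmx G); first by rewrite unitmx_inv.
rewrite !mulmxA -trmx_mul mulmxV // trmx1 mul1mx.
by rewrite -mulmxA mulmxV // mulmx1.
Qed.

Lemma congruent_trans (M1 M2 M3 : 'M[F]_2) :
  congruent M1 M2 -> congruent M2 M3 -> congruent M1 M3.
Proof.
case=> G uG <- [H uH <-]; exists (G *m H); first by rewrite unitmx_mul uG.
by rewrite trmx_mul !mulmxA.
Qed.

Lemma proj_point_eqP (p q x y : F) :
  proj_point p q = proj_point x y <->
  exists c : F, [/\ c != 0, x = c * p & y = c * q].
Proof.
split=> [e|[c [c0 -> ->]]].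
  have : proj_point x y (vec2 x y).
    by exists 1; [exact: oner_neq0 | rewrite scale1r].
  rewrite -e => -[c /= c0 /rowP e2]; exists c.
  by split=> //; [move: (e2 0) | move: (e2 1)]; rewrite !mxE.
have vE : vec2 (c * p) (c * q) = c *: vec2 p q.
  by apply/rowP => j; rewrite !mxE; case: ifP.
rewrite /proj_point vE; apply/seteqP; split=> v [d /= d0 <-].
  by exists (d / c); rewrite /= ?mulf_neq0 ?invr_eq0 // scalerA divfK.
by exists (d * c); rewrite /= ?mulf_neq0 // scalerA.
Qed.

Lemma sym_act_tperm (p q : F) :
  sym_act (tperm 0 1) (proj_point p q) = proj_point q p.
Proof.
have vE : col_perm (tperm 0 1) (vec2 p q) = vec2 q p.
  apply/rowP => j; rewrite !mxE.
  have [->|->] : j = 0 \/ j = 1; rewrite ?tpermL ?tpermR //.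
  by case: j => [[|[|//]] j2]; [left | right]; apply: val_inj.
have cE c : col_perm (tperm 0 1) (c *: vec2 p q) = c *: vec2 q p.
  by rewrite -vE; apply/rowP => j; rewrite !mxE.
apply/seteqP; split=> [v [w [c c0 <-] <-]|v [c c0 <-]].
  by exists c => //; rewrite cE.
by exists (c *: vec2 p q); [exists c | rewrite cE].
Qed.

End Definitions.

(* Since [set T] unfolds to [T -> Prop], F would otherwise be implicit. *)
Arguments P1 F : clear implicits.
Arguments P1_mod_sym F : clear implicits.
Arguments B_classes F : clear implicits.

(* Main.v *)
Require Import Defs.
From mathcomp Require Import all_boot all_order all_algebra all_fingroup.
From mathcomp Require Import boolp classical_sets functions reals complex.
From mathcomp Require Import ring.

Set Implicit Arguments.
Unset Strict Implicit.
Unset Printing Implicit Defensive.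

Import GRing.Theory.
Local Open Scope classical_set_scope.
Local Open Scope ring_scope.

(** Under a congruence by [G], the determinant [- p * q] of [B p q] is
multiplied by [\det G ^+ 2], while the off-diagonal entry [p - q] of the
alternating part [B p q - (B p q)^T] is multiplied by [\det G], because
alternating forms on a plane are all proportional. Writing [d] for [\det G],
a congruence from [B p q] to [B x y] thus gives [x - y = d * p - d * q] and
[x * y = d * p * (d * q)]. So [x] and [- y] have the sum and the product of
[d * p] and [- d * q], hence are these two numbers in some order, and
[(x, y)] is [d] times [(p, q)] or [- d] times [(q, p)]
([congruent_B_proj_point]).

Conversely, [diag(1, c)] rescales [(p, q)] by [c] ([congruent_B_scale]). For
the interchange of [p] and [q] ([congruent_B_swap]), take a basis [e1], [e2]
in which the form has matrix [B p q]. Both [e2] and [(p + q) e1 - e2] are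
isotropic, and replacing [e2] by the latter swaps the two mixed values of the
form, since [p + q - p = q] and [p + q - q = p].

The bijection is then formal: the orbit of [(p : q)] under the symmetric group
consists of [(p : q)] and [(q : p)], so that equality of orbits and congruence
of the matrices are the same relation between [(p, q)] and [(x, y)]. Everything
holds over an arbitrary field. *)

Section AnyField.
Variable F : fieldType.
Implicit Types (p q x y c : F) (G M : 'M[F]_2).

Lemma ord2_eq (i : 'I_2) : i = 0 \/ i = 1.
Proof. by case: i => [[|[|//]] i2]; [left | right]; apply: val_inj. Qed.

Lemma mx2P M M' :
  [/\ M 0 0 = M' 0 0, M 0 1 = M' 0 1, M 1 0 = M' 1 0 & M 1 1 = M' 1 1] ->
  M = M'.
Proof.
case=> e00 e01 e10 e11; apply/matrixP => i j.
by have [->|->] := ord2_eq i; have [->|->] := ord2_eq j.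
Qed.

Lemma det_mx2E M : \det M = M 0 0 * M 1 1 - M 0 1 * M 1 0.
Proof.
have lift01 : lift ord0 ord0 = 1 :> 'I_2 by apply: val_inj.
have lift10 : lift 1 ord0 = 0 :> 'I_2 by apply: val_inj.
rewrite (expand_det_row _ 0) !big_ord_recl big_ord0 addr0 lift01 /cofactor.
by rewrite !det_mx11 !mxE lift01 lift10 /= expr0 expr1 mul1r mulN1r mulrN.
Qed.

Lemma congr_mx2E G M (i j : 'I_2) :
  (G^T *m M *m G) i j =
  (G 0 i * M 0 0 + G 1 i * M 1 0) * G 0 j +
  (G 0 i * M 0 1 + G 1 i * M 1 1) * G 1 j.
Proof.
have lift01 : lift ord0 ord0 = 1 :> 'I_2 by apply: val_inj.
by rewrite mxE !big_ord_recl !big_ord0 !addr0 !mxE !big_ord_recl !big_ord0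
  !addr0 lift01 !mxE.
Qed.

(** The alternating part of a form on a plane is a multiple of the determinant
form, so a change of basis multiplies it by the determinant. *)
Lemma congr_mx2_alt G M :
  (G^T *m M *m G) 0 1 - (G^T *m M *m G) 1 0 = \det G * (M 0 1 - M 1 0).
Proof. by rewrite !congr_mx2E det_mx2E; ring. Qed.

Lemma det_B p q : \det (B p q) = - (p * q).
Proof. by rewrite det_mx2E !mxE /= mulr0 sub0r. Qed.

Lemma congruent_B_scale p q c :
  c != 0 -> congruent (B p q) (B (c * p) (c * q)).
Proof.
move=> c0; pose G : 'M[F]_2 :=
  \matrix_(i, j) if i == j then if i == 0 then 1 else c else 0.
exists G; first by rewrite unitmxE det_mx2E !mxE /= mul1r mul0r subr0 unitfE.
by apply: mx2P; rewrite !congr_mx2E !mxE /=; split; ring.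
Qed.

(** The isotropic line spanned by [e2] is traded for the other isotropic line,
spanned by [(p + q) e1 - e2]. When [p + q = 0] the two lines coincide and the
change of basis only flips the sign of [e2], sending [(p, -p)] to
[(-p, p)]. *)
Lemma congruent_B_swap p q : congruent (B p q) (B q p).
Proof.
pose G : 'M[F]_2 :=
  \matrix_(i, j) if i == 0 then (if j == 0 then 1 else p + q)
                 else (if j == 0 then 0 else -1).
exists G.
  by rewrite unitmxE det_mx2E !mxE /= mulr0 subr0 mul1r unitrN unitr1.
by apply: mx2P; rewrite !congr_mx2E !mxE /=; split; ring.
Qed.

Lemma congruent_B_proj_point p q x y :
  congruent (B p q) (B x y) ->
  proj_point p q = proj_point x y \/ proj_point p q = proj_point y x.
Proof.
case=> G; rewrite unitmxE unitfE; set d := \det G => d0 eB.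
have e_sub : x - y = d * (p - q).
  by have := congr_mx2_alt G (B p q); rewrite eB !mxE.
have e_mul : x * y = d ^+ 2 * (p * q).
  have := congr1 determinant eB; rewrite !det_mulmx det_tr !det_B -/d.
  by rewrite mulrN mulNr => /oppr_inj <-; ring.
have ey : y = x - d * (p - q) by rewrite -e_sub; ring.
(* The roots of X^2 - (x - y) X - x y are x and - y, and also d p and - d q. *)
have /eqP : (x - d * p) * (x + d * q) = 0.
  suff -> : (x - d * p) * (x + d * q) =
    x * (x - d * (p - q)) - d ^+ 2 * (p * q) by rewrite -ey e_mul subrr.
  by ring.
rewrite mulf_eq0 => /orP[/eqP ex|/eqP ex]; [left | right].
  have {}ex : x = d * p by apply/eqP; rewrite -subr_eq0 ex.
  by apply/proj_point_eqP; exists d; split=> //; rewrite ey ex; ring.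
have {}ex : x = - d * q by rewrite mulNr; apply/eqP; rewrite -addr_eq0 ex.
apply/proj_point_eqP; exists (- d); split; first by rewrite oppr_eq0.
  by rewrite ey ex; ring.
exact: ex.
Qed.

Lemma congruent_BP p q x y :
  congruent (B p q) (B x y) <->
  proj_point p q = proj_point x y \/ proj_point p q = proj_point y x.
Proof.
split; first exact: congruent_B_proj_point.
have same a b : proj_point p q = proj_point a b -> congruent (B p q) (B a b).
  by case/proj_point_eqP=> c [c0 -> ->]; apply: congruent_B_scale.
by case=> /same // h; apply: congruent_trans h (congruent_B_swap _ _).
Qed.

Lemma perm2_eq (s : 'S_2) : s = 1%g \/ s = tperm 0 1.
Proof.
have s_neq : s 0 != s 1 by rewrite (inj_eq perm_inj).
have [s0|s0] := ord2_eq (s 0); have [s1|s1] := ord2_eq (s 1);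
  rewrite s0 s1 // in s_neq; [left | right]; apply/permP => i;
  by have [->|->] := ord2_eq i; rewrite ?perm1 ?tpermL ?tpermR.
Qed.

Lemma sym_act1 (L : set 'rV[F]_2) : sym_act 1%g L = L.
Proof.
by rewrite /sym_act (_ : col_perm 1 = id) ?image_id //; apply: funext => v;
  rewrite col_perm1.
Qed.

Lemma sym_orbit_proj_point p q :
  sym_orbit (proj_point p q) = [set proj_point p q; proj_point q p].
Proof.
apply/seteqP; split=> [L [s _ <-]|L [->|->]].
- by have [->|->] := perm2_eq s; rewrite ?sym_act1 ?sym_act_tperm;
    [left | right].
- by exists 1%g; rewrite ?sym_act1.
- by exists (tperm 0 1); rewrite ?sym_act_tperm.
Qed.

Lemma proj_point_swap p q x y :
  proj_point p q = proj_point x y -> proj_point q p = proj_point y x.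
Proof. by rewrite -!(sym_act_tperm p) -!(sym_act_tperm x) => ->. Qed.

Lemma sym_orbit_proj_pointP p q x y :
  sym_orbit (proj_point p q) = sym_orbit (proj_point x y) <->
  proj_point p q = proj_point x y \/ proj_point p q = proj_point y x.
Proof.
rewrite !sym_orbit_proj_point; split=> [e|].
  have : [set proj_point x y; proj_point y x] (proj_point p q).
    by rewrite -e; left.
  by [].
by case=> e; rewrite e (proj_point_swap e) // setUC.
Qed.

Lemma congruence_class_eqP M M' :
  congruence_class M = congruence_class M' <-> congruent M M'.
Proof.
split=> [e|MM'].
  suff : congruence_class M M' by [].
  by rewrite e; apply: congruent_refl.
apply/seteqP; split=> N MN; apply: congruent_trans MN => //.
exact: congruent_sym.
Qed.

Lemma congruence_class_BP p q x y :
  congruence_class (B p q) = congruence_class (B x y) <->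
  sym_orbit (proj_point p q) = sym_orbit (proj_point x y).
Proof.
by rewrite congruence_class_eqP congruent_BP sym_orbit_proj_pointP.
Qed.

(** Taking the union of the congruence classes over all coordinates of the
given orbit avoids choosing a representative; by [congruence_class_BP] all
these classes are the same. *)
Definition orbit_class (S : set (set 'rV[F]_2)) : set 'M[F]_2 :=
  [set M | exists p q,
     S = sym_orbit (proj_point p q) /\ congruence_class (B p q) M].

Lemma orbit_classE p q :
  orbit_class (sym_orbit (proj_point p q)) = congruence_class (B p q).
Proof.
apply/seteqP; split=> [M [x [y [/congruence_class_BP -> //]]]|M BM].
by exists p, q.
Qed.

Lemma orbit_class_bij : set_bij (P1_mod_sym F) (B_classes F) orbit_class.
Proof.
split.
- by move=> _ [_ [p [q ->]] <-]; exists p, q; rewrite orbit_classE.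
- move=> S T /set_mem[_ [p [q ->]] <-] /set_mem[_ [x [y ->]] <-].
  by rewrite !orbit_classE => /congruence_class_BP.
- move=> _ [p [q ->]]; exists (sym_orbit (proj_point p q)).
    by exists (proj_point p q) => //; exists p, q.
  exact: orbit_classE.
Qed.

End AnyField.

Theorem theorem9p3 (R : realType) :
  [/\ forall p q c : R[i], c != 0 -> congruent (B p q) (B (c * p) (c * q)),
      forall p q x y : R[i],
        congruent (B p q) (B x y) <->
        proj_point p q = proj_point x y \/ proj_point p q = proj_point y x
    & exists f : set (set 'rV[R[i]]_2) -> set 'M[R[i]]_2,
        (forall p q : R[i],
           f (sym_orbit (proj_point p q)) = congruence_class (B p q)) /\
        set_bij (P1_mod_sym R[i]) (B_classes R[i]) f ].
Proof.
split; [exact: congruent_B_scale | exact: congruent_BP |].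
exists (@orbit_class R[i]); split; [exact: orbit_classE | exact: orbit_class_bij].
Qed.
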